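(* Let $A$ be a torsion-free abelian group and $(A,(\cdot,\cdot),R)$ a tame irreducible affine reflection system of type $A_1$. Then the hyperbolic Weyl group $\widetilde{\mathcal{W}}$ of $R$ is a central extension of the Weyl group $\mathcal{W}$ of $R$ by the center $Z(\widetilde{\mathcal{W}})$; namely, $$1\longrightarrow Z(\widetilde{\mathcal{W}})\stackrel{i}{\hookrightarrow}\widetilde{\mathcal{W}}\stackrel{\varphi}{\longrightarrow}\mathcal{W}\longrightarrow 1$$ is a short exact sequence, where $i$ is the inclusion and $\varphi(w)=w|_{\mathcal{V}}$ for $w\in\widetilde{\mathcal{W}}$.
   Context: Let $A$ be a torsion-free abelian group with a nontrivial symmetric positive semidefinite bi-homomorphism $(\cdot,\cdot):A\times A\to\mathbb{Q}$, with radical $A^0=\{\alpha\in A:(\alpha,A)=0\}$. For $B\subseteq A$ put $B^\times=B\setminus A^0$, $B^0=B\cap A^0$. Put $(\beta,\alpha^\vee)=2(\beta,\alpha)/(\alpha,\alpha)$ if $(\alpha,\alpha)\neq0$ and $(\beta,\alpha^\vee)=0$ otherwise. A subset $R\subseteq A$ is an affine reflection system if (R1) $R=-R$; (R2) $R$ generates $A$; (R3) for $\alpha\in R^\times$, $\beta\in R$ there are $d,u\in\mathbb{Z}_{\ge0}$ with $(\beta+\mathbb{Z}\alpha)\cap R=\{\beta-d\alpha,\dots,\beta+u\alpha\}$ and $d-u=(\beta,\alpha^\vee)$. It is irreducible if $R^\times$ is not a disjoint union of two nonempty orthogonal subsets, and tame if $R^0\subseteq R^\times-R^\times$. Its type is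 the type of its image in $A/A^0$ (a locally finite root system); type $A_1$ means that this image is $\{0,\pm\bar\epsilon\}$. For $R$ tame irreducible of type $A_1$ it is known that $R=(S+S)\cup(\dot R+S)$ with $\dot R=\{0,\pm\epsilon\}$, $S\subseteq R^0$, $0\in S$, $S\pm2S\subseteq S$, $\langle S\rangle=A^0$, and $A=\mathbb{Z}\epsilon\oplus A^0$. Fix such $\epsilon$, $S$, normalized so that $(\epsilon,\epsilon)=2$. The Weyl group $\mathcal{W}$ of $R$ is the subgroup of $\mathrm{Aut}(A)$ generated by all $w_\alpha(\beta)=\beta-(\beta,\alpha^\vee)\alpha$, $\alpha\in R$. Let $\mathcal{V}=\mathbb{Q}\otimes_{\mathbb{Z}}A$ with the extended form; identify $A$, $R$ with subsets of $\mathcal{V}$, and regard $\mathcal{W}$ as acting on $\mathcal{V}$ by linear extension. Let $\mathcal{V}^0=\mathbb{Q}\otimes A^0$, so $\mathcal{V}=\mathbb{Q}\epsilon\oplus\mathcal{V}^0$. Fix a basis $\{\sigma_j\mid j\in J\}\subseteq S$ of $\mathcal{V}^0$; let $\lambda_j\in(\mathcal{V}^0)^\star$ (the dual space) be given by $\lambda_j(\sigma_i)=\delta_{ij}$, and $(\mathcal{V}^0)^\dagger=\sum_{j\in J}\mathbb{Q}\lambda_j$. Put $\widetilde{\mathcal{V}}=\mathcal{V}\oplus(\mathcal{V}^0)^\dagger$ and extend the form to a non-degenerate symmetric bilinear form on $\widetilde{\mathcal V}$ by $(\epsilon,(\mathcal{V}^0)^\dagger)=((\mathcal{V}^0)^\dagger,(\mathcal{V}^0)^\dagger)=0$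 and $(\sigma,\lambda)=\lambda(\sigma)$ for $\sigma\in\mathcal{V}^0$, $\lambda\in(\mathcal{V}^0)^\dagger$. For $\alpha\in\mathcal{V}$ let $w_\alpha\in\mathrm{Aut}(\widetilde{\mathcal{V}})$, $w_\alpha(\beta)=\beta-(\beta,\alpha^\vee)\alpha$ (same convention for $\alpha^\vee$). The hyperbolic Weyl group $\widetilde{\mathcal{W}}$ is the subgroup of $\mathrm{Aut}(\widetilde{\mathcal{V}})$ generated by $w_\alpha$, $\alpha\in R$.
   Formalization: The radical A^0 is assumed to be nonzero; for A^0 = 0 one has R = {0, ±ε}, both Weyl groups have order 2 and equal their centers, and φ is injective, so the sequence is not exact. *)

(* Defs.v *)
From HB Require Import structures.
From mathcomp Require Import all_boot all_order all_algebra.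
From mathcomp Require Import ring lra.
From mathcomp Require Import boolp classical_sets functions.

Set Implicit Arguments.
Unset Strict Implicit.
Unset Printing Implicit Defensive.

Import Order.TTheory GRing.Theory Num.Theory.
Local Open Scope classical_set_scope.
Local Open Scope ring_scope.
Local Open Scope quotient_scope.

Section Symmetric.
Variable T : Type.

Record sym := Sym {
  sym_fun :> T -> T;
  sym_inv : T -> T;
  sym_funK : cancel sym_fun sym_inv;
  sym_invK : cancel sym_inv sym_fun }.

HB.instance Definition _ := gen_eqMixin sym.
HB.instance Definition _ := gen_choiceMixin sym.

Lemma symP (f g : sym) : f =1 g -> f = g.
Proof.
case: f g => [f f' fK f'K] [g g' gK g'K] /= efg.
have {}efg : f = g by apply: funext.
move: efg fK f'K => -> fK f'K.
have eq' : f' = g' by apply: funext => x; rewrite -[RHS]fK g'K.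
move: eq' fK f'K => -> fK f'K.
by congr Sym; apply: Prop_irrelevance.
Qed.

Definition sym_one : sym := @Sym idfun idfun (fun=> erefl) (fun=> erefl).
Definition sym_mul (f g : sym) : sym :=
  Sym (can_comp (sym_funK f) (sym_funK g)) (can_comp (sym_invK g) (sym_invK f)).
Definition sym_opp (f : sym) : sym := Sym (sym_invK f) (sym_funK f).

Fact sym_mulA : associative sym_mul.
Proof. by move=> f g h; apply: symP. Qed.
Fact sym_mul1 : left_id sym_one sym_mul.
Proof. by move=> f; apply: symP. Qed.
Fact sym_mulr1 : right_id sym_one sym_mul.
Proof. by move=> f; apply: symP. Qed.
Fact sym_mulV : left_inverse sym_one sym_opp sym_mul.
Proof. by move=> f; apply: symP => x; apply: sym_funK. Qed.
Fact sym_mulrV : right_inverse sym_one sym_opp sym_mul.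
Proof. by move=> f; apply: symP => x; apply: sym_invK. Qed.

HB.instance Definition _ :=
  isGroup.Build sym sym_mulA sym_mul1 sym_mulr1 sym_mulV sym_mulrV.

End Symmetric.

Section Generated.
Variable G : groupType.

Definition is_subgroup (H : set G) : Prop :=
  [/\ H 1%g, forall x y, H x -> H y -> H (x * y)%g & forall x, H x -> H x^-1%g].

Variable X : set G.

Definition generated : {pred G} := fun g => `[< smallest is_subgroup X g >].

Fact generated_closed : group_closed generated.
Proof.
split=> [|x y]; first by apply/asboolP => H [[]].
move=> /asboolP Hx /asboolP Hy; apply/asboolP => H [HH XH].
case: (HH) => _ HM HV; apply: HM; first exact: Hx.
by apply: HV; apply: Hy.
Qed.

Record gen_group := GenGroup {
  gen_val : G;
  gen_valP : gen_val \in generated }.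

HB.instance Definition _ := [isSub for gen_val].
HB.instance Definition _ := [Choice of gen_group by <:].
HB.instance Definition _ :=
  SubChoice_isSubGroup.Build G generated gen_group generated_closed.

End Generated.

Section Center.
Variable G : groupType.

Definition center_pred : {pred G} := fun z => `[< forall g : G, commute z g >].

Fact center_closed : group_closed center_pred.
Proof.
split=> [|x y /asboolP cx /asboolP cy]; apply/asboolP => g.
  by rewrite /commute mul1g mulg1.
have cy' : commute g y^-1%g.
  by apply: (mulgI y); rewrite mulgA (cy g) mulgK mulVKg.
by rewrite /commute -mulgA -cy' mulgA cx mulgA.
Qed.

Record center_group := CenterGroup {
  center_val : G;
  center_valP : center_val \in center_pred }.

HB.instance Definition _ := [isSub for center_val].
HB.instance Definition _ := [Choice of center_group by <:].
HB.instance Definition _ :=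
  SubChoice_isSubGroup.Build G center_pred center_group center_closed.

Fact center_valM : {morph center_val : x y / (x * y)%g}.
Proof. by []. Qed.
HB.instance Definition _ := isMultiplicative.Build center_group G center_val center_valM.

End Center.

Definition short_exact (Z G H : groupType) (i : {multiplicative Z -> G})
    (p : {multiplicative G -> H}) : Prop :=
  [/\ injective i,
      range i = [set g | p g = 1%g] &
      range p = setT].

Definition central_extension (Z G H : groupType) (i : {multiplicative Z -> G})
    (p : {multiplicative G -> H}) : Prop :=
  short_exact i p /\ forall z g, commute (i z) g.

Section Automorphisms.

Section Zmodule.
Variable A : zmodType.

Definition additive_pred : {pred sym A} :=
  fun f => `[< {morph f : x y / x + y} >].

Fact additive_pred_closed : group_closed additive_pred.
Proof.
split=> [|f g /asboolP fD /asboolP gD]; apply/asboolP => // x y /=.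
by rewrite -fD; congr (sym_fun f _); apply: (can_inj (sym_funK g));
  rewrite gD !sym_invK.
Qed.

Record Aut := MkAut { Aut_val :> sym A; Aut_valP : Aut_val \in additive_pred }.

HB.instance Definition _ := [isSub for Aut_val].
HB.instance Definition _ := [Choice of Aut by <:].
HB.instance Definition _ :=
  SubChoice_isSubGroup.Build (sym A) additive_pred Aut additive_pred_closed.
End Zmodule.

Section Lmodule.
Variables (K : nzRingType) (V : lmodType K).

Definition linear_pred : {pred sym V} := fun f => `[< linear f >].

Fact linear_pred_closed : group_closed linear_pred.
Proof.
split=> [|f g /asboolP fL /asboolP gL]; apply/asboolP => // a x y /=.
by rewrite -fL; congr (sym_fun f _); apply: (can_inj (sym_funK g));
  rewrite gL !sym_invK.
Qed.

Record GL := MkGL { GL_val :> sym V; GL_valP : GL_val \in linear_pred }.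

HB.instance Definition _ := [isSub for GL_val].
HB.instance Definition _ := [Choice of GL by <:].
HB.instance Definition _ :=
  SubChoice_isSubGroup.Build (sym V) linear_pred GL linear_pred_closed.
End Lmodule.

End Automorphisms.

(* Q (x) A is built as the module of fractions a / n: the pair (a, n)
   stands for a / (n + 1).  The lemma QtensorP is the universal property
   of the tensor product of Q and A over the integers. *)

Section Qtensor.
Variable A : zmodType.

Definition Qeqv (x y : A * nat) : bool :=
  `[< exists2 k : nat, (0 < k)%N
      & x.1 *+ (y.2.+1 * k) = y.1 *+ (x.2.+1 * k) >].

Fact Qeqv_refl : reflexive Qeqv.
Proof. by move=> x; apply/asboolP; exists 1%N. Qed.

Fact Qeqv_sym : symmetric Qeqv.
Proof. by move=> x y; apply/asboolP/asboolP => -[k k0 e]; exists k. Qed.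

Fact Qeqv_trans : transitive Qeqv.
Proof.
move=> [b n] [a m] [c p] /asboolP[k k0 /= e1] /asboolP[l l0 /= e2].
apply/asboolP; exists (n.+1 * k * l)%N => /=; first by rewrite !muln_gt0 k0 l0.
have -> : (p.+1 * (n.+1 * k * l) = (n.+1 * k) * (p.+1 * l))%N by ring.
rewrite mulrnA e1 -mulrnA.
have -> : (m.+1 * k * (p.+1 * l) = (p.+1 * l) * (m.+1 * k))%N by ring.
rewrite mulrnA e2 -mulrnA; congr (_ *+ _); ring.
Qed.

Canonical Qeqv_equiv := EquivRel Qeqv Qeqv_refl Qeqv_sym Qeqv_trans.

Definition Qtensor : Type := {eq_quot Qeqv}.

HB.instance Definition _ := Choice.on Qtensor.
HB.instance Definition _ : EqQuotient _ Qeqv Qtensor := EqQuotient.on Qtensor.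

Definition Qfrac (a : A) (n : nat) : Qtensor := \pi_Qtensor (a, n.-1).

Lemma Qfrac_eq (a b : A) (m n : nat) : (0 < m)%N -> (0 < n)%N ->
  Qfrac a m = Qfrac b n <->
  exists2 k, (0 < k)%N & a *+ (n * k) = b *+ (m * k).
Proof.
case: m => // m _; case: n => // n _; split.
  by move/eqmodP/asboolP.
by move=> ?; apply/eqmodP/asboolP.
Qed.

Definition Qnum (u : Qtensor) : A := (repr u).1.
Definition Qden (u : Qtensor) : nat := (repr u).2.+1.

Lemma Qfrac_num_den u : u = Qfrac (Qnum u) (Qden u).
Proof. by rewrite /Qfrac /Qnum /Qden /= -surjective_pairing reprK. Qed.

Lemma Qden_gt0 u : (0 < Qden u)%N. Proof. by []. Qed.
Hint Resolve Qden_gt0 : core.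

Variant Qspec : Qtensor -> Type :=
  QSpec a n of (0 < n)%N : Qspec (Qfrac a n).

Lemma QP u : Qspec u.
Proof. by rewrite (Qfrac_num_den u); constructor. Qed.

Lemma Qnum_den a m : (0 < m)%N ->
  exists2 k, (0 < k)%N & a *+ (Qden (Qfrac a m) * k)
                         = Qnum (Qfrac a m) *+ (m * k).
Proof. by move=> m0; apply/Qfrac_eq => //; exact: Qfrac_num_den. Qed.

Definition Qzero : Qtensor := Qfrac 0 1.
Definition Qopp (u : Qtensor) : Qtensor := Qfrac (- Qnum u) (Qden u).
Definition Qadd (u v : Qtensor) : Qtensor :=
  Qfrac (Qnum u *+ Qden v + Qnum v *+ Qden u) (Qden u * Qden v).
Definition Qscale (q : rat) (u : Qtensor) : Qtensor :=
  Qfrac (Qnum u *~ numq q) (Qden u * `|denq q|).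

Lemma QaddE a b m n : (0 < m)%N -> (0 < n)%N ->
  Qadd (Qfrac a m) (Qfrac b n) = Qfrac (a *+ n + b *+ m) (m * n).
Proof.
move=> m0 n0; apply/Qfrac_eq; rewrite ?muln_gt0 ?m0 ?n0 //.
have [k k0] := Qnum_den a m0; have [l l0] := Qnum_den b n0; rewrite /Qadd.
set a' := Qnum (Qfrac a m); set m' := Qden (Qfrac a m).
set b' := Qnum (Qfrac b n); set n' := Qden (Qfrac b n) => eb ea.
exists (k * l)%N; rewrite ?muln_gt0 ?k0 //.
rewrite !mulrnDl -!mulrnA.
have -> : (n' * (m * n * (k * l)) = m * k * (n' * (n * l)))%N by ring.
have -> : (m' * (m * n * (k * l)) = n * l * (m' * (m * k)))%N by ring.
rewrite mulrnA -ea [b' *+ _]mulrnA -eb -!mulrnA.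
by congr (_ *+ _ + _ *+ _); ring.
Qed.

Lemma QoppE a m : (0 < m)%N -> Qopp (Qfrac a m) = Qfrac (- a) m.
Proof.
move=> m0; apply/Qfrac_eq => //.
have [k k0 ea] := Qnum_den a m0.
by exists k; rewrite ?mulNrn ?ea.
Qed.

Lemma absdenq_gt0 q : (0 < `|denq q|)%N.
Proof. by rewrite absz_gt0 denq_neq0. Qed.
Hint Resolve absdenq_gt0 : core.

Lemma QscaleE q a m : (0 < m)%N ->
  Qscale q (Qfrac a m) = Qfrac (a *~ numq q) (m * `|denq q|).
Proof.
move=> m0; apply/Qfrac_eq; rewrite ?muln_gt0 ?m0 ?absdenq_gt0 //.
have [k k0 ea] := Qnum_den a m0.
have swap y z N : (y *~ z) *+ N = (y *+ N) *~ z by rewrite !pmulrn mulrzAC.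
exists k => //; rewrite !swap; congr (_ *~ _).
have -> : (m * `|denq q| * k = m * k * `|denq q|)%N by ring.
rewrite mulrnA -ea -mulrnA; congr (_ *+ _); ring.
Qed.

Lemma Qfrac_mulz a (x y : int) m n : (0 < m)%N -> (0 < n)%N ->
  x * n%:Z = y * m%:Z -> Qfrac (a *~ x) m = Qfrac (a *~ y) n.
Proof.
move=> m0 n0 e; apply/Qfrac_eq => //; exists 1%N => //.
by rewrite !muln1 !pmulrn -!mulrzA e.
Qed.

Lemma QscaleE_div (x : int) (d : nat) a m : (0 < m)%N -> (0 < d)%N ->
  Qscale (x%:~R / d%:R) (Qfrac a m) = Qfrac (a *~ x) (m * d).
Proof.
move=> m0 d0; rewrite QscaleE //; set q := _ / _.
apply: Qfrac_mulz; rewrite ?muln_gt0 ?m0 ?d0 ?absdenq_gt0 //.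
apply: (@intr_inj rat); rewrite !PoszM !rmorphM /= numqE absz_denq.
by rewrite /q; field; rewrite pnatr_eq0 -lt0n.
Qed.

Lemma rat_div (q : rat) : exists x d, (0 < d)%N /\ q = x%:~R / d%:R.
Proof.
exists (numq q), `|denq q|%N; split=> //.
by rewrite -{1}[q]divq_num_den -[X in _ = _ / X]/((`|denq q|%:Z)%:~R) absz_denq.
Qed.

Lemma Qfrac_id a n d : (0 < n)%N -> (0 < d)%N ->
  Qfrac (a *+ d) (n * d) = Qfrac a n.
Proof.
move=> n0 d0; apply/Qfrac_eq; rewrite ?muln_gt0 ?n0 //.
by exists 1%N; rewrite // -mulrnA; congr (_ *+ _); ring.
Qed.

Fact QaddA : associative Qadd.
Proof.
move=> u v w; case: (QP u) (QP v) (QP w) => a m m0 [b n n0] [c p p0].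
rewrite !QaddE ?muln_gt0 ?m0 ?n0 ?p0 //; congr Qfrac; last exact: mulnA.
by rewrite !mulrnDl addrA -!mulrnA; congr (_ *+ _ + _ *+ _ + _ *+ _); ring.
Qed.

Fact QaddC : commutative Qadd.
Proof.
move=> u v; case: (QP u) (QP v) => a m m0 [b n n0].
by rewrite !QaddE // addrC mulnC.
Qed.

Fact Qadd0 : left_id Qzero Qadd.
Proof.
move=> u; case: (QP u) => a m m0.
by rewrite /Qzero !QaddE // mul0rn add0r mulr1n mul1n.
Qed.

Fact QaddN : left_inverse Qzero Qopp Qadd.
Proof.
move=> u; case: (QP u) => a m m0; rewrite QoppE // QaddE //.
rewrite mulNrn addNr; apply/Qfrac_eq; rewrite ?muln_gt0 ?m0 //.
by exists 1%N; rewrite // !mul0rn.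
Qed.

HB.instance Definition _ := GRing.isZmodule.Build Qtensor QaddA QaddC Qadd0 QaddN.

Fact QscaleA q r u : Qscale q (Qscale r u) = Qscale (q * r) u.
Proof.
case: (QP u) => a m m0.
have [x [d [d0 ->]]] := rat_div q; have [y [e [e0 ->]]] := rat_div r.
have -> : x%:~R / d%:R * (y%:~R / e%:R) = (y * x)%:~R / (e * d)%:R :> rat.
  by rewrite natrM rmorphM /= mulf_div [d%:R * _]mulrC [_%:~R * _]mulrC.
by rewrite !QscaleE_div ?muln_gt0 ?m0 ?d0 ?e0 // mulrzA mulnA.
Qed.

Fact Qscale1 : left_id 1 Qscale.
Proof.
move=> u; case: (QP u) => a m m0.
have -> : 1 = 1%:~R / 1%:R :> rat by rewrite divr1.
by rewrite QscaleE_div // muln1.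
Qed.

Fact QscaleDr : right_distributive Qscale +%R.
Proof.
move=> q u v; case: (QP u) (QP v) => a m m0 [b n n0].
have [x [d [d0 ->]]] := rat_div q.
rewrite -[_ (Qfrac a m) _]/(Qadd _ _) -[RHS]/(Qadd _ _).
rewrite !(QaddE, QscaleE_div) ?muln_gt0 ?m0 ?n0 ?d0 //.
apply/Qfrac_eq; rewrite ?muln_gt0 ?m0 ?n0 ?d0 //.
have swap y z N : (y *~ z) *+ N = (y *+ N) *~ z by rewrite !pmulrn mulrzAC.
exists 1%N; rewrite // !swap -!mulrzDl !swap; congr (_ *~ _).
by rewrite !mulrnDl -!mulrnA; congr (_ *+ _ + _ *+ _); ring.
Qed.

Fact QscaleDl u : {morph Qscale^~ u : q r / q + r}.
Proof.
move=> q r; case: (QP u) => a m m0.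
have [x [d [d0 ->]]] := rat_div q; have [y [e [e0 ->]]] := rat_div r.
have -> : x%:~R / d%:R + y%:~R / e%:R
          = (x * e + y * d)%:~R / (d * e)%:R :> rat.
  rewrite natrM rmorphD !rmorphM /=; field.
  by rewrite !pnatr_eq0 -!lt0n d0 e0.
rewrite -[RHS]/(Qadd _ _) !(QaddE, QscaleE_div) ?muln_gt0 ?m0 ?d0 ?e0 //.
rewrite !pmulrn -!mulrzA -mulrzDr; apply: Qfrac_mulz;
  rewrite ?muln_gt0 ?m0 ?d0 ?e0 // !PoszM; ring.
Qed.

HB.instance Definition _ := GRing.Zmodule_isLmodule.Build rat Qtensor
  QscaleA Qscale1 QscaleDr QscaleDl.

Definition Qinj (a : A) : Qtensor := Qfrac a 1.

Lemma Qinj_is_additive : {morph Qinj : a b / a + b}.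
Proof. by move=> a b; rewrite -[RHS]/(Qadd _ _) QaddE. Qed.

Lemma QfracE a n : (0 < n)%N -> Qfrac a n = n%:R^-1 *: Qinj a.
Proof.
move=> n0; rewrite -[_^-1]mul1r -[1]/(1%:~R) -[RHS]/(Qscale _ _).
by rewrite QscaleE_div // mulr1z mul1n.
Qed.

Lemma Qtensor_gen (u : Qtensor) : exists q a, u = q *: Qinj a.
Proof. by case: (QP u) => a n n0; exists n%:R^-1, a; exact: QfracE. Qed.

Lemma Qinj_inj : (forall (a : A) n, (0 < n)%N -> a *+ n = 0 -> a = 0) ->
  injective Qinj.
Proof.
move=> tf a b /Qfrac_eq[] // k k0; rewrite mul1n => e.
by apply/eqP; rewrite -subr_eq0; apply/eqP/(tf _ _ k0); rewrite mulrnBl e subrr.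
Qed.

Definition biadditive (W : zmodType) (f : rat -> A -> W) : Prop :=
  (forall q, {morph f q : a b / a + b}) /\ (forall a, {morph f^~ a : q r / q + r}).

Definition Qlift (W : zmodType) (f : rat -> A -> W) (u : Qtensor) : W :=
  f (Qden u)%:R^-1 (Qnum u).

Section Lift.
Variables (W : zmodType) (f : rat -> A -> W).
Hypothesis fD : biadditive f.

Fact biadditiveMn q a n : f q (a *+ n) = f (q *+ n) a.
Proof.
case: fD => fr fl; have f0r : f q 0 = 0.
  by apply: (addrI (f q 0)); rewrite -fr !addr0.
have f0l : f 0 a = 0 by apply: (addrI (f 0 a)); rewrite -fl !addr0.
by elim: n => [|n IH]; rewrite ?mulr0n ?f0r ?f0l // !mulrS fr fl IH.
Qed.

Lemma Qlift_frac a m : (0 < m)%N -> Qlift f (Qfrac a m) = f m%:R^-1 a.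
Proof.
move=> m0; rewrite /Qlift; have [k k0] := Qnum_den a m0.
set D := Qden _; set N := Qnum _ => e.
have D0 : (0 < D)%N by [].
have -> : D%:R^-1 = (D * m * k)%:R^-1 *+ (m * k) :> rat.
  rewrite -mulr_natr !natrM; field.
  by rewrite !pnatr_eq0 -!lt0n m0 k0 D0.
rewrite -biadditiveMn -e biadditiveMn; congr f.
rewrite -mulr_natr !natrM; field.
by rewrite !pnatr_eq0 -!lt0n m0 k0 D0.
Qed.

Lemma QliftE q a : Qlift f (q *: Qinj a) = f q a.
Proof.
have [x [d [d0 ->]]] := rat_div q.
rewrite -[_ *: _]/(Qscale _ _) QscaleE_div // Qlift_frac ?mul1n //.
case: fD => fr fl; have fN r b : f r (- b) = f (- r) b.
  apply: (addIr (f r b)); rewrite -(fr r (- b) b) -[RHS](fl b (- r) r) !addNr.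
  by have := biadditiveMn r b 0; rewrite !mulr0n.
case: x => n; first by rewrite -!pmulrn biadditiveMn // mulr_natl.
rewrite NegzE !mulrNz fN -!pmulrn biadditiveMn // mulNr mulr_natl.
by rewrite -mulNrn.
Qed.

Lemma Qlift_additive : {morph Qlift f : u v / u + v}.
Proof.
move=> u v; case: (QP u) (QP v) => a m m0 [b n n0].
rewrite -[_ + _]/(Qadd _ _) QaddE // !Qlift_frac ?muln_gt0 ?m0 ?n0 //.
case: (fD) => -> _; rewrite !biadditiveMn; congr (f _ _ + f _ _);
by rewrite -mulr_natr natrM; field; rewrite !pnatr_eq0 -!lt0n m0 n0.
Qed.
End Lift.

Lemma QtensorP (W : zmodType) (f : rat -> A -> W) : biadditive f ->
  exists! g : Qtensor -> W,
    {morph g : u v / u + v} /\ forall q a, g (q *: Qinj a) = f q a.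
Proof.
move=> fD; exists (Qlift f); split=> [|g [gD gE]].
  by split; [exact: Qlift_additive | exact: QliftE].
apply: funext => u; have [q [a ->]] := Qtensor_gen u.
by rewrite gE QliftE.
Qed.

Lemma Qtensor_biadditive : biadditive (fun q a => q *: Qinj a).
Proof.
split=> [q a b|a q r]; last exact: scalerDl.
by rewrite Qinj_is_additive scalerDr.
Qed.

End Qtensor.

(* Linear extension id (x) g, and below the extension of a form, along Qinj. *)
Definition Qmap (A B : zmodType) (g : A -> B) : Qtensor A -> Qtensor B :=
  Qlift (fun q a => q *: Qinj (g a)).

Definition Qform (A : zmodType) (F : A -> A -> rat) (u v : Qtensor A) : rat :=
  Qlift (fun q a => Qlift (fun r b => q * r * F a b) v) u.

Lemma QmapE (A B : zmodType) (g : A -> B) : {morph g : a b / a + b} ->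
  forall q a, Qmap g (q *: Qinj a) = q *: Qinj (g a).
Proof.
move=> gD q a; apply: QliftE; split=> [r x y|x r s]; last exact: scalerDl.
by rewrite gD Qinj_is_additive scalerDr.
Qed.

Lemma QformE (A : zmodType) (F : A -> A -> rat) :
  (forall a, {morph F a : x y / x + y}) ->
  (forall a, {morph F^~ a : x y / x + y}) ->
  forall q a r b, Qform F (q *: Qinj a) (r *: Qinj b) = q * r * F a b.
Proof.
move=> Fr Fl q a r b.
have H s c : biadditive (fun t d => s * t * F c d).
  by split=> [t x y|x t t'] /=; rewrite ?Fr; ring.
rewrite /Qform QliftE ?QliftE //; split=> [t x y|x t t'] /=;
  have [p [d ->]] := Qtensor_gen (r *: Qinj b).
  by rewrite !QliftE // Fl; ring.
by rewrite !QliftE //; ring.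
Qed.

Record psd_form (A : zmodType) := PsdForm {
  form_val :> A -> A -> rat;
  form_additive : forall a, {morph form_val a : x y / x + y};
  form_sym : forall a b, form_val a b = form_val b a;
  form_ge0 : forall a, 0 <= form_val a a;
  form_nontrivial : exists a b, form_val a b != 0 }.

Section Radical.
Variables (A : zmodType) (F : psd_form A).

Definition radical : {pred A} := fun a => `[< forall b, F a b = 0 >].

Fact radical_closed : zmod_closed radical.
Proof.
have F0 b : F b 0 = 0.
  by apply: (addrI (F b 0)); rewrite -form_additive !addr0.
split=> [|x y /asboolP x0 /asboolP y0]; apply/asboolP => b; rewrite form_sym //.
apply: (addIr (F b y)); rewrite -form_additive subrK.
by rewrite ![F b _]form_sym x0 y0 addr0.
Qed.

HB.instance Definition _ := GRing.isZmodClosed.Build A radical radical_closed.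

Record radical_group := RadicalGroup {
  radical_val :> A;
  radical_valP : radical_val \in radical }.

HB.instance Definition _ := [isSub for radical_val].
HB.instance Definition _ := [Choice of radical_group by <:].
HB.instance Definition _ := [SubChoice_isSubZmodule of radical_group by <:].

End Radical.

(* (b, a^vee); used for the form on A and for the one on Vtilde. *)
Definition cartan (T : Type) (B : T -> T -> rat) (b a : T) : rat :=
  if B a a == 0 then 0 else 2 * B b a / B a a.

Definition torsion_free (A : zmodType) : Prop :=
  forall (a : A) (n : nat), (0 < n)%N -> a *+ n = 0 -> a = 0.

Definition is_additive_subgroup (A : zmodType) (H : set A) : Prop :=
  [/\ H 0, forall x y, H x -> H y -> H (x + y) & forall x, H x -> H (- x)].

Definition sumset (A : zmodType) (X Y : set A) : set A :=
  [set x + y | x in X & y in Y].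

Section ReflectionSystem.
Variables (A : zmodType) (F : psd_form A) (R : set A).

Definition isotropic_part : set A := R `&` [set a | a \in radical F].
Definition nonisotropic_part : set A := R `\` [set a | a \in radical F].

Definition affine_reflection_system : Prop :=
  [/\ R = [set - a | a in R],
      smallest (@is_additive_subgroup A) R = setT &
      forall a b, nonisotropic_part a -> R b ->
        exists d u : nat,
          [set b + a *~ n | n in [set: int]] `&` R =
            [set b + a *~ n | n in [set n : int | - d%:Z <= n <= u%:Z]] /\
          d%:R - u%:R = cartan F b a].

Definition irreducible : Prop :=
  ~ exists R1 R2 : set A,
      [/\ R1 !=set0, R2 !=set0, R1 `&` R2 = set0,
          R1 `|` R2 = nonisotropic_part &
          forall a b, R1 a -> R2 b -> F a b = 0].

Definition tame : Prop :=
  isotropic_part `<=` [set a - b | a in nonisotropic_part & b in nonisotropic_part].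

Definition type_A1 : Prop :=
  exists2 e : {ideal_quot (radical F)}, e != 0 &
    [set \pi_{ideal_quot (radical F)} a | a in R] = [set 0] `|` [set e] `|` [set - e].

(* For a in R the rational (b, a^vee) is an integer n, which lets the
   reflection be written in A itself; weyl_reflection_exists below shows that
   every root does give an automorphism. *)
Definition weyl_reflections : set (Aut A) :=
  [set w | exists2 a, R a &
     forall b, exists2 n : int, n%:~R = cartan F b a & w b = b - a *~ n].

Definition A1_datum (eps : A) (S : set A) : Prop :=
  [/\ R = sumset S S `|` sumset ([set 0] `|` [set eps] `|` [set - eps]) S,
      S `<=` isotropic_part,
      S 0,
      sumset S [set s *+ 2 | s in S] `<=` S
        /\ sumset S [set - (s *+ 2) | s in S] `<=` S &
      smallest (@is_additive_subgroup A) S = [set a | a \in radical F]]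
  /\ (forall a, exists! p : int * A, p.2 \in radical F /\ a = eps *~ p.1 + p.2)
  /\ F eps eps = 2.

End ReflectionSystem.

Section Families.
Variables (M : lmodType rat) (J : eqType) (b : J -> M).

Definition span_pred : {pred M} :=
  fun v => `[< exists s : seq (rat * J), v = \sum_(p <- s) p.1 *: b p.2 >].

Fact span_closed : submod_closed span_pred.
Proof.
split=> [|a u v /asboolP[s ->] /asboolP[t ->]]; apply/asboolP.
  by exists [::]; rewrite big_nil.
exists ([seq (a * p.1, p.2) | p <- s] ++ t).
rewrite big_cat big_map /= scaler_sumr; congr (_ + _).
by apply: eq_bigr => p _; rewrite scalerA.
Qed.

Record span_space := SpanSpace {
  span_val :> M;
  span_valP : span_val \in span_pred }.

HB.instance Definition _ := [isSub for span_val].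
HB.instance Definition _ := [Choice of span_space by <:].
HB.instance Definition _ :=
  GRing.SubChoice_isSubLmodule.Build rat M span_pred span_space span_closed.

Definition is_basis : Prop :=
  (forall (s : seq J) (c : J -> rat), uniq s ->
     \sum_(j <- s) c j *: b j = 0 -> forall j, j \in s -> c j = 0)
  /\ forall v, v \in span_pred.
End Families.

Section Hyperbolic.
Variables (A : zmodType) (F : psd_form A).

Definition V0 : Type := Qtensor (radical_group F).
HB.instance Definition _ := GRing.Lmodule.on V0.

Definition V0_incl : V0 -> Qtensor A := Qmap (@radical_val A F).

Variables (J : eqType) (sigma : J -> radical_group F) (lambda : J -> {scalar V0}).

Definition dual_family : Prop :=
  forall i j, lambda j (Qinj (sigma i)) = (i == j)%:R.

Definition V0_dagger : Type := span_space (fun j => lambda j : V0 -> rat^o).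
HB.instance Definition _ := GRing.Lmodule.on V0_dagger.

(* (v, l) stands for the sum v + l. *)
Definition Vtilde : Type := (Qtensor A * V0_dagger)%type.
HB.instance Definition _ := GRing.Lmodule.on Vtilde.

Definition hyperbolic_form (eps : A) (B : Vtilde -> Vtilde -> rat) : Prop :=
  [/\ forall x, scalar (B x),
      forall x y, B x y = B y x &
      forall x, (forall y, B x y = 0) -> x = 0]
  /\ [/\ forall v w : Qtensor A, B (v, 0) (w, 0) = Qform F v w,
      forall l : V0_dagger, B (Qinj eps, 0) (0, l) = 0,
      forall l m : V0_dagger, B (0, l) (0, m) = 0 &
      forall (s : V0) (l : V0_dagger), B (V0_incl s, 0) (0, l) = span_val l s].

Variables (R : set A) (B : Vtilde -> Vtilde -> rat).

Definition hyperbolic_reflections : set (GL Vtilde) :=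
  [set w | exists2 a, R a &
     let a' : Vtilde := (Qinj a, 0) in
     forall x, w x = x - cartan B x a' *: a'].

End Hyperbolic.

Notation weyl_group F R := (gen_group (weyl_reflections F R)).
Notation hyperbolic_weyl_group R B := (gen_group (hyperbolic_reflections R B)).

Lemma weyl_reflection_exists (A : zmodType) (F : psd_form A) (R : set A) a :
  affine_reflection_system F R -> R a ->
  exists w : Aut A, forall b,
    exists2 n : int, n%:~R = cartan F b a & w b = b - a *~ n.
Proof.
move=> [_ gR R3] Ra; have [Fa0|Fa0] := eqVneq (F a a) 0.
  exists 1%g => b; exists 0; last by rewrite mulr0z subr0.
  by rewrite /cartan Fa0 eqxx.
have cD x y : cartan F (x + y) a = cartan F x a + cartan F y a.
  rewrite /cartan (negbTE Fa0) (form_sym F (x + y)) (form_sym F x) (form_sym F y) form_additive.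
  by rewrite mulrDr mulrDl.
have c0 : cartan F 0 a = 0 by apply: (addrI (cartan F 0 a)); rewrite -cD !addr0.
have cN x : cartan F (- x) a = - cartan F x a.
  by apply: (addIr (cartan F x a)); rewrite -cD !addNr.
have aR : nonisotropic_part F R a.
  by split=> //= /asboolP /(_ a) e; rewrite e eqxx in Fa0.
have cZ b : exists n : int, n%:~R = cartan F b a.
  have : [set: A] b by [].
  rewrite -gR => /(_ [set b | exists n : int, n%:~R = cartan F b a]) /=.
  apply; split=> [|c /(R3 a c aR)[d [u [_ e]]]]; last first.
    by exists (d%:Z - u%:Z); rewrite -e rmorphB.
  split=> [|x y [m em] [n en]|x [m em]]; first by exists 0; rewrite c0.
    by exists (m + n); rewrite rmorphD /= em en cD.
  by exists (- m); rewrite rmorphN /= em cN.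
pose n b := numq (cartan F b a).
have nE b : (n b)%:~R = cartan F b a by rewrite /n; have [m <-] := cZ b; rewrite numq_int.
have nD x y : n (x + y) = n x + n y.
  by apply: (@intr_inj rat); rewrite rmorphD /= !nE cD.
pose r b := b - a *~ n b.
have rD x y : r (x + y) = r x + r y by rewrite /r nD mulrzDr opprD addrACA.
have cr b : cartan F (r b) a = - cartan F b a.
  have ca : cartan F a a = 2 by rewrite /cartan (negbTE Fa0) mulfK.
  have cz (m : int) : cartan F (a *~ m) a = m%:~R * 2.
    have cn (k : nat) : cartan F (a *+ k) a = k%:R * 2.
      elim: k => [|k IH]; first by rewrite mulr0n c0 mul0r.
      by rewrite mulrS cD IH ca -natr1; ring.
    case: m => k; first by rewrite -!pmulrn cn.
    by rewrite NegzE !mulrNz cN -!pmulrn cn mulNr.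
  by rewrite /r cD cN cz nE; ring.
have rK : cancel r r.
  move=> b; have nr : n (r b) = - n b.
    by apply: (@intr_inj rat); rewrite rmorphN /= !nE cr.
  by rewrite {1}/r nr mulrNz opprK /r subrK.
exists (MkAut (Aut_val := Sym rK rK) (introT (asboolP _) rD)) => b.
by exists (n b); rewrite ?nE.
Qed.

Lemma linear_reflection_exists (V : lmodType rat) (B : V -> V -> rat) (a : V) :
  (forall x, scalar (B x)) -> (forall x y, B x y = B y x) ->
  exists w : GL V, forall x, w x = x - cartan B x a *: a.
Proof.
move=> Bl Bs; have [Ba0|Ba0] := eqVneq (B a a) 0.
  by exists 1%g => x; rewrite /cartan Ba0 eqxx scale0r subr0.
pose c x := cartan B x a.
have cL k x y : c (k *: x + y) = k * c x + c y.
  by rewrite /c /cartan (negbTE Ba0) (Bs (_ + _)) (Bs x) (Bs y) Bl; ring.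
have ca : c a = 2 by rewrite /c /cartan (negbTE Ba0) mulfK.
pose r x := x - c x *: a.
have rL : linear r.
  move=> k x y; rewrite /r cL scalerDl opprD addrACA scalerBr scalerA.
  by [].
have rK : cancel r r.
  move=> x; rewrite {1}/r.
  have -> : c (r x) = - c x.
    by rewrite /r addrC -scaleNr cL ca; ring.
  by rewrite scaleNr opprK /r subrK.
by exists (MkGL (GL_val := Sym rK rK) (introT (asboolP _) rL)).
Qed.

Lemma Qtensor_ind_add (A : zmodType) (u v : Qtensor A) :
  exists q a b, u = q *: Qinj a /\ v = q *: Qinj b.
Proof.
case: (QP u) (QP v) => a m m0 [b n n0].
exists (m * n)%:R^-1, (a *+ n), (b *+ m); rewrite -!QfracE ?muln_gt0 ?m0 //.
by rewrite Qfrac_id // [(m * n)%N]mulnC Qfrac_id.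
Qed.

Lemma Qmap_linear (A B : zmodType) (g : A -> B) :
  {morph g : a b / a + b} -> linear (Qmap g).
Proof.
move=> gD k u v; have [q [a [b [-> ->]]]] := Qtensor_ind_add u v.
have D : {morph Qmap g : x y / x + y}.
  apply: Qlift_additive; split=> [r x y|x r s]; last exact: scalerDl.
  by rewrite gD Qinj_is_additive scalerDr.
by rewrite D scalerA !QmapE // scalerA.
Qed.

Lemma Qform_scalar (A : zmodType) (F : psd_form A) u : scalar (Qform F u).
Proof.
have Fl a : {morph F^~ a : x y / x + y}.
  by move=> x y /=; rewrite !(form_sym F _ a) form_additive.
have Fr := form_additive F.
move=> k v w; have [q [a [b [-> ->]]]] := Qtensor_ind_add v w.
have [r [c ->]] := Qtensor_gen u.
have [x [d [d0 ->]]] := rat_div k.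
have -> : (x%:~R / d%:R) *: (q *: Qinj a) + q *: Qinj b
        = (q / d%:R) *: Qinj (a *~ x + b *+ d).
  have nE (e : A) n : Qinj (e *+ n) = n%:R *: Qinj e.
    elim: n => [|n IH].
      by rewrite scale0r; apply: (addrI (Qinj 0)); rewrite -Qinj_is_additive !addr0.
    by rewrite mulrS Qinj_is_additive IH -natr1 scalerDl scale1r addrC.
  have NE (e : A) : Qinj (- e) = - Qinj e.
    apply: (addIr (Qinj e)); rewrite -Qinj_is_additive !addNr.
    by rewrite -[0]/(0 *+ 0) nE scale0r.
  have zE (e : A) (n : int) : Qinj (e *~ n) = n%:~R *: Qinj e.
    case: n => n; first by rewrite -!pmulrn nE.
    by rewrite NegzE !mulrNz NE -!pmulrn nE scaleNr.
  rewrite Qinj_is_additive zE nE scalerDr !scalerA.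
  by congr (_ *: _ + _ *: _); field; rewrite pnatr_eq0 -lt0n.
rewrite !QformE // Fr.
have Fn n e : F c (e *+ n) = n%:R * F c e.
  elim: n => [|n IH]; first by apply: (addrI (F c 0)); rewrite -Fr mul0r !addr0.
  by rewrite mulrS Fr IH -natr1; ring.
have FN e : F c (- e) = - F c e.
  by apply: (addIr (F c e)); rewrite -Fr !addNr -[0]/(0 *+ 0) Fn mul0r.
have -> : F c (a *~ x) = x%:~R * F c a.
  case: (x) => n; first by rewrite -!pmulrn Fn.
  by rewrite NegzE !mulrNz FN -!pmulrn Fn mulNr.
by rewrite Fn; field; rewrite pnatr_eq0 -lt0n.
Qed.

Lemma Qform_sym (A : zmodType) (F : psd_form A) u v : Qform F u v = Qform F v u.
Proof.
have Fl a : {morph F^~ a : x y / x + y}.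
  by move=> x y /=; rewrite !(form_sym F _ a) form_additive.
have Fr := form_additive F.
have [q [a ->]] := Qtensor_gen u; have [r [b ->]] := Qtensor_gen v.
by rewrite !QformE // (form_sym F a b); ring.
Qed.

Lemma basis_dual_eq0 (M : lmodType rat) (J : eqType) (b : J -> M)
    (f : J -> {scalar M}) (v : M) :
  is_basis b -> (forall i j, f j (b i) = (i == j)%:R) ->
  (forall j, f j v = 0) -> v = 0.
Proof.
move=> [_ /(_ v) /asboolP[s ->]] fb f0; pose r := undup [seq p.2 | p <- s].
have -> : \sum_(p <- s) p.1 *: b p.2
        = \sum_(j <- r) (\sum_(p <- s) p.1 * (p.2 == j)%:R) *: b j.
  under [RHS]eq_bigr do rewrite scaler_suml.
  rewrite exchange_big /=; apply: eq_big_seq => p ps.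
  have pr : p.2 \in r by rewrite mem_undup map_f.
  rewrite (bigD1_seq p.2) ?undup_uniq //= eqxx mulr1 big1 ?addr0 // => j.
  by rewrite eq_sym => /negbTE ->; rewrite mulr0 scale0r.
rewrite big1 // => j _; have := f0 j; rewrite linear_sum.
under eq_bigr do rewrite linearZ /= fb.
by move=> ->; rewrite scale0r.
Qed.

Lemma hyperbolic_form_exists (A : zmodType) (F : psd_form A) (R S : set A)
    (J : eqType) (eps : A) (sigma : J -> radical_group F)
    (lambda : J -> {scalar V0 F}) :
  A1_datum F R eps S -> is_basis (fun j => Qinj (sigma j) : V0 F) ->
  dual_family sigma lambda ->
  exists B : Vtilde lambda -> Vtilde lambda -> rat, hyperbolic_form eps B.
Proof.
move=> [_ [dec F2]] basis dual.
have Fr := form_additive F.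
have Fl a : {morph F^~ a : x y / x + y}.
  by move=> x y /=; rewrite !(form_sym F _ a) Fr.
have /choice[h hE] : forall a, exists p : int * radical_group F,
    a = eps *~ p.1 + radical_val p.2.
  by move=> a; have [[n s] [[/= sr e] _]] := dec a; exists (n, RadicalGroup sr).
have hU a n (s : radical_group F) : a = eps *~ n + radical_val s -> h a = (n, s).
  move=> e; have [p [_ pU]] := dec a.
  have e1 := pU (n, radical_val s) (conj (radical_valP s) e).
  have e2 := pU ((h a).1, radical_val (h a).2) (conj (radical_valP _) (hE a)).
  move: e2; rewrite e1 => -[en es]; rewrite [h a]surjective_pairing -en.
  by congr (_, _); apply: val_inj; rewrite /= -es.
pose P a := (h a).2.
have PD : {morph P : a b / a + b}.
  move=> a b; rewrite /P.
  rewrite (hU (a + b) ((h a).1 + (h b).1) ((h a).2 + (h b).2)) //.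
  by rewrite mulrzDr addrACA -!hE.
have PD' := Qmap_linear PD.
have iD : {morph @radical_val A F : a b / a + b} by [].
pose PV : Qtensor A -> V0 F := Qmap P.
have Pe : PV (Qinj eps) = 0.
  rewrite -[Qinj eps]scale1r /PV (QmapE PD) /P (hU eps 1 0) ?mulr1z ?addr0 //=.
  by apply/eqP; rewrite scale1r; apply/eqP/(addrI (Qinj (0 : radical_group F)));
    rewrite -Qinj_is_additive !addr0.
have Pi (s : V0 F) : PV (V0_incl s) = s.
  have [q [a ->]] := Qtensor_gen s; rewrite /V0_incl /PV (QmapE iD) (QmapE PD).
  by rewrite /P (hU (radical_val a) 0 a) //= mulr0z add0r.
have VE v : exists c, v = c *: Qinj eps + V0_incl (PV v).
  have [q [a ->]] := Qtensor_gen v; exists (q * (h a).1%:~R).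
  rewrite /V0_incl /PV (QmapE PD) (QmapE iD) {1}[a]hE Qinj_is_additive scalerDr.
  congr (_ + _); rewrite -scalerA; congr (_ *: _).
  have := @QscaleE_div A (h a).1 1 eps 1 isT isT.
  by rewrite muln1 divr1 => e; symmetry; exact: e.
have lL (l : V0_dagger lambda) : scalar (span_val l).
  case: l => l /= /asboolP[s ->] k x y.
  have E z : (\sum_(p <- s) p.1 *: (lambda p.2 : V0 F -> rat^o)) z
             = \sum_(p <- s) p.1 * lambda p.2 z.
    by elim: s => [|p s IH]; rewrite ?big_nil // !big_cons -IH.
  rewrite !E mulr_sumr -big_split /=; apply: eq_bigr => p _.
  by rewrite linearP /=; ring.
have incl_rad (s : V0 F) v : Qform F v (V0_incl s) = 0.
  have [q [a ->]] := Qtensor_gen s; have [r [b ->]] := Qtensor_gen v.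
  rewrite /V0_incl (QmapE iD) QformE // form_sym.
  by have /asboolP -> := radical_valP a; rewrite mulr0.
have l0 (l : V0_dagger lambda) : span_val l 0 = 0.
  by have := lL l (-1) 0 0; rewrite scaler0 addr0 mulN1r addNr.
have Q0 u : Qform F u 0 = 0.
  by have := Qform_scalar F u (-1) 0 0; rewrite scaler0 addr0 mulN1r addNr.
have Q0l u : Qform F 0 u = 0 by rewrite Qform_sym Q0.
have PV0 : PV 0 = 0 by have := PD' (-1) 0 0; rewrite scaler0 addr0 scaleN1r addNr.
pose ev (l : V0_dagger lambda) (t : V0 F) : rat := span_val l t.
have el0 l : ev l 0 = 0 by exact: l0.
have e0 t : ev 0 t = 0 by [].
exists (fun x y : Vtilde lambda => Qform F x.1 y.1 + ev y.2 (PV x.1) + ev x.2 (PV y.1)).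
split; split.
- move=> x k y z; rewrite -[(k *: y + z).1]/(k *: y.1 + z.1).
  have -> : PV (k *: y.1 + z.1) = k *: PV y.1 + PV z.1 by exact: PD'.
  rewrite Qform_scalar [ev x.2 (_ + _)]lL.
  rewrite -[ev (k *: y + z).2 _]/(k * ev y.2 (PV x.1) + ev z.2 (PV x.1)) /ev; ring.
- by move=> x y; rewrite Qform_sym; ring.
- move=> [v l] H; have v0 : PV v = 0.
    apply: (basis_dual_eq0 basis dual) => j.
    have lj : (lambda j : V0 F -> rat^o) \in span_pred (fun j => lambda j : V0 F -> rat^o).
      by apply/asboolP; exists [:: (1, j)]; rewrite big_seq1 scale1r.
    have := H (0, SpanSpace lj); rewrite /= PV0 el0 Q0 add0r addr0.
    by [].
  have [c vc] := VE v.
  have vE : v = 0.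
    rewrite vc v0 /V0_incl; have -> : Qmap (@radical_val A F) 0 = 0.
      by have := Qmap_linear iD (-1) 0 0; rewrite scaler0 addr0 scaleN1r addNr.
    have := H (Qinj eps, 0); rewrite /= v0 Pe !el0 !addr0.
    rewrite Qform_sym vc Qform_scalar incl_rad addr0.
    rewrite -[Qinj eps]scale1r QformE // F2 => /eqP.
    by rewrite !mul1r mulf_eq0 orbF => /eqP ->; rewrite scale0r.
  congr (_, _) => //; apply: val_inj; apply: funext => t /=.
  have := H (V0_incl t, 0); rewrite /= vE Q0l Pi PV0 add0r => e.
  exact: e.
- by move=> v w; rewrite -[LHS]/(Qform F v w + 0 + 0) !addr0.
- move=> l; rewrite -[LHS]/(Qform F (Qinj eps) 0 + ev l (PV (Qinj eps)) + 0).
  by rewrite Q0 Pe el0 !addr0.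
- move=> l m; rewrite -[LHS]/(Qform F 0 0 + ev m (PV 0) + ev l (PV 0)).
  by rewrite Q0 PV0 !el0 !addr0.
- move=> s l; rewrite -[LHS]/(Qform F (V0_incl s) 0 + ev l (PV (V0_incl s)) + 0).
  by rewrite Q0 Pi add0r addr0.
Qed.

(* Main.v *)
Require Import Defs.
From HB Require Import structures.
From mathcomp Require Import all_boot all_order all_algebra.
From mathcomp Require Import boolp classical_sets functions.
From mathcomp Require Import ring.

Import Order.TTheory GRing.Theory Num.Theory.
Local Open Scope classical_set_scope.
Local Open Scope ring_scope.

(** The generators of the hyperbolic Weyl group are isometries preserving V and
    fixing V^0 pointwise, and restricting them to V gives the generators of the
    Weyl group; this yields phi and its surjectivity. An isometry z fixing V
    pointwise satisfies z w_a = w_(z a) z = w_a z, so the kernel is central.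
    Conversely a central z satisfies w_(z a) = w_a, hence z a = a or z a = - a for
    every nonisotropic root a. Since z fixes V^0, comparing the roots eps and
    eps + s for some nonzero s in S excludes z eps = - eps, so that z fixes
    V = Q eps + V^0. *)

(** * Induction over the generators of a group *)

Lemma generated_ind (G : groupType) (X P : set G) :
  is_subgroup P -> X `<=` P -> forall g, g \in generated X -> P g.
Proof. by move=> sP XP g /asboolP; apply; split. Qed.

Lemma mem_generated (G : groupType) (X : set G) x : X x -> x \in generated X.
Proof. by move=> Xx; apply/asboolP => P [_]; apply. Qed.

(** * Reflections and isometries for a symmetric bilinear form over the rationals *)

Section Reflections.
Context {V : lmodType rat} (B : V -> V -> rat).
Hypothesis B_scalar : forall x, scalar (B x).
Hypothesis B_sym : forall x y, B x y = B y x.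

Definition isometry (w : GL V) := forall x y, B (w x) (w y) = B x y.

Lemma isometry_subgroup : is_subgroup isometry.
Proof.
split=> // [f g fB gB x y|f fB x y]; first by rewrite -(gB x) -(fB (g x)).
have fK u : f (f^-1%g u) = u by exact: sym_invK.
by rewrite -(fB (f^-1%g x)) !fK.
Qed.

Lemma formBZr x y k a : B x (y - k *: a) = B x y - k * B x a.
Proof. by rewrite addrC -scaleNr B_scalar; ring. Qed.

Lemma formZr x k a : B x (k *: a) = k * B x a.
Proof.
have := B_scalar x k a 0; rewrite addr0 => ->.
by have := B_scalar x (-1) 0 0; rewrite scaler0 addr0 => ->; ring.
Qed.

Lemma reflection_isometry (w : GL V) a :
  (forall x, w x = x - cartan B x a *: a) -> isometry w.
Proof.
move=> wE x y; rewrite !wE formBZr !(B_sym (_ - _)) !formBZr /cartan.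
(* If [B a a = 0], the default value 0 of [cartan] makes [w] the identity; otherwise the terms in
   [B x a * B y a] cancel. *)
by rewrite (B_sym y x) (B_sym a x); have [_|Ba] := eqVneq; [ring|field].
Qed.

(** Conjugation by [z] turns the reflection in [a] into the one in [z a], which is [a] again;
    isotropic [a] are covered too. *)
Lemma isometry_commute {z w : GL V} {a} : isometry z ->
  (forall x, w x = x - cartan B x a *: a) -> z a = a -> commute z w.
Proof.
move=> zB wE za; apply/val_inj/symP => x.
rewrite -[LHS]/(z (w x)) -[RHS]/(w (z x)) !wE addrC -scaleNr.
have /asboolP -> := GL_valP z; rewrite za addrC scaleNr.
by rewrite /cartan -(zB x) za.
Qed.

(** As [B a a] is nonzero, the eigenspace of [w] for -1 is the line through [a]. A commuting [z]
    preserves this line, and an isometry can scale [a] only by a square root of 1. *)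
Lemma commute_reflection {z w : GL V} {a} : isometry z ->
  (forall x, w x = x - cartan B x a *: a) -> B a a != 0 -> commute z w ->
  z a = a \/ z a = - a.
Proof.
move=> zB wE Ba zw.
have wa : w a = - a.
  rewrite wE /cartan (negbTE Ba) mulfK // -[X in X - _]scale1r -scalerBl.
  by rewrite -scaleN1r; congr (_ *: _); ring.
have zN x : z (- x) = - z x.
  have /asboolP zl := GL_valP z.
  have z0 : z 0 = 0 by have := zl (-1) 0 0; rewrite scaler0 addr0 scaleN1r addNr.
  by have := zl (-1) x 0; rewrite z0 !addr0 !scaleN1r.
pose c := cartan B (z a) a.
(* Evaluating [z w = w z] at [a] gives - z a = z a - c a. *)
have zaE : z a = (c / 2) *: a.
  have e : z (w a) = w (z a) by rewrite -[LHS]/((z * w)%g a) zw.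
  move: e; rewrite wa zN wE -/c => e.
  have {}e : 2 *: z a = c *: a.
    rewrite scaler_nat mulr2n -[X in _ + X]opprK e opprB addrC subrK //.
  by rewrite [c / 2]mulrC -scalerA -e scalerA mulVf // scale1r.
have : (c / 2) ^+ 2 == 1.
  by have := zB a a; rewrite zaE formZr B_sym formZr mulrA -expr2 -[RHS]mul1r
    => /(mulIf Ba) ->.
by rewrite sqrf_eq1 zaE => /orP[]/eqP->; [left; rewrite scale1r|right; rewrite scaleN1r].
Qed.

End Reflections.

(** * Extending automorphisms and forms from A to its rational span *)

Section Qtensor.
Variable A : zmodType.

Lemma Aut_additive (g : Aut A) : {morph g : a b / a + b}.
Proof. by have /asboolP := Aut_valP g. Qed.

Lemma Qmap_Qinj (g : Aut A) a : Qmap g (Qinj a) = Qinj (g a).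
Proof. by rewrite -[Qinj a]scale1r QmapE ?scale1r //; exact: Aut_additive. Qed.

Lemma Qmap1 v : Qmap (1%g : Aut A) v = v.
Proof. by have [q [a ->]] := Qtensor_gen v; rewrite QmapE. Qed.

Lemma QmapM (g h : Aut A) v : Qmap (g * h)%g v = Qmap g (Qmap h v).
Proof.
by have [q [a ->]] := Qtensor_gen v; rewrite !QmapE //; exact: Aut_additive.
Qed.

(** Without torsion A embeds in its rational span, so an automorphism is recovered from its
    extension. *)
Lemma Qmap_inj (g h : Aut A) : torsion_free A -> Qmap g =1 Qmap h -> g = h.
Proof.
move=> tA gh; apply/val_inj/symP => a.
by apply: (Qinj_inj tA); rewrite -[LHS]Qmap_Qinj -[RHS]Qmap_Qinj.
Qed.

Lemma Qinj0 : Qinj (0 : A) = 0.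
Proof. by apply: (addrI (Qinj 0)); rewrite -Qinj_is_additive !addr0. Qed.

Lemma QinjN (a : A) : Qinj (- a) = - Qinj a.
Proof. by apply: (addrI (Qinj a)); rewrite -Qinj_is_additive !subrr Qinj0. Qed.

Lemma QinjMz (a : A) n : Qinj (a *~ n) = n%:~R *: Qinj a.
Proof.
(* The scalar is read as n / 1 and the vector as a / 1. *)
have := @QscaleE_div A n 1 a 1 isT isT.
by rewrite muln1 divr1 => e; symmetry; exact: e.
Qed.

Variable F : psd_form A.

Lemma form_additivel b : {morph F^~ b : x y / x + y}.
Proof. by move=> x y /=; rewrite !(form_sym F _ b) form_additive. Qed.

Lemma Qform_Qinj q a b : Qform F (q *: Qinj a) (Qinj b) = q * F a b.
Proof.
rewrite -[Qinj b]scale1r QformE ?mulr1 //.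
  exact: form_additive.
exact: form_additivel.
Qed.

End Qtensor.

(** * Passing between the hyperbolic Weyl group and the Weyl group *)

Section Restriction.
Context {A : zmodType} {F : psd_form A} {J : eqType}.
Context {lambda : J -> {scalar V0 F}}.
Variables (R : set A) (eps : A) (B : Vtilde lambda -> Vtilde lambda -> rat).
Hypothesis formB : hyperbolic_form eps B.

(** Elements of the Weyl group act on A only, so the restriction to V is compared with their linear
    extension; that [w] preserves V is part of the condition. *)
Definition restricts_to (w : GL (Vtilde lambda)) (g : Aut A) :=
  forall v, w (v, 0) = (Qmap g v, 0).

Lemma restricts_toM w w' g g' : restricts_to w g -> restricts_to w' g' ->
  restricts_to (w * w')%g (g * g')%g.
Proof. by move=> wg wg' v; rewrite QmapM -wg -wg'. Qed.

Lemma restricts_to1 : restricts_to 1%g 1%g.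
Proof. by move=> v; rewrite Qmap1. Qed.

Lemma restricts_toV w g : restricts_to w g -> restricts_to w^-1%g g^-1%g.
Proof.
move=> wg v; have vE : v = Qmap g (Qmap g^-1%g v) by rewrite -QmapM mulgV Qmap1.
by rewrite {1}vE -wg; exact: sym_funK.
Qed.

Lemma restricts_to_uniq w g h : torsion_free A ->
  restricts_to w g -> restricts_to w h -> g = h.
Proof.
by move=> tA wg wh; apply: Qmap_inj => // v; have := wg v; rewrite wh => -[].
Qed.

Lemma cartan_Qinj q b a :
  cartan B (q *: Qinj b, 0) (Qinj a, 0) = q * cartan F b a.
Proof.
have [_ [BE _ _ _]] := formB.
have Baa : B (Qinj a, 0) (Qinj a, 0) = F a a.
  by rewrite BE -[X in Qform _ X]scale1r Qform_Qinj mul1r.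
by rewrite /cartan Baa BE Qform_Qinj; case: eqP => _; ring.
Qed.

(** On A both reflections subtract the same integral multiple of [a], and A spans V. *)
Lemma reflection_restricts_to (w : GL (Vtilde lambda)) (g : Aut A) a :
  (forall x, w x = x - cartan B x (Qinj a, 0) *: ((Qinj a, 0) : Vtilde lambda)) ->
  (forall b, exists2 n : int, n%:~R = cartan F b a & g b = b - a *~ n) ->
  restricts_to w g.
Proof.
move=> wE gE v; have [q [b ->]] := Qtensor_gen v.
rewrite wE cartan_Qinj QmapE; last exact: Aut_additive.
have [n nE ->] := gE b.
rewrite Qinj_is_additive QinjN QinjMz nE scalerBr scalerA.
by congr (_, _); rewrite /= scaler0 subr0.
Qed.

Lemma hyperbolic_isometry (w : hyperbolic_weyl_group R B) : isometry B (gen_val w).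
Proof.
have [[Bl Bs _] _] := formB.
apply: generated_ind (gen_valP w); first exact: isometry_subgroup.
by move=> {}w [a Ra wE]; apply: reflection_isometry wE.
Qed.

Lemma hyperbolic_fix_radical (w : hyperbolic_weyl_group R B) s :
  s \in radical F -> gen_val w (Qinj s, 0) = (Qinj s, 0).
Proof.
move=> /asboolP s0.
apply: (@generated_ind _ _
  (fun w : GL (Vtilde lambda) => w (Qinj s, 0) = (Qinj s, 0)) _ _ _ (gen_valP w)).
  split=> // [f g fs gs|f fs]; first by rewrite -{2}fs -{2}gs.
  by rewrite -{1}fs; exact: sym_funK.
move=> {}w [a Ra wE] /=.
(* As [s] is orthogonal to A, both branches of [cartan] are 0. *)
rewrite wE -{2}[Qinj s]scale1r cartan_Qinj /cartan s0 mulr0 mul0r if_same mulr0.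
by rewrite scale0r subr0.
Qed.

(** On generators, the reflection of A exists because the string property of roots makes the Cartan
    numbers integers. *)
Lemma hyperbolic_restricts : affine_reflection_system F R ->
  forall w : hyperbolic_weyl_group R B,
  exists g : weyl_group F R, restricts_to (gen_val w) (gen_val g).
Proof.
move=> ars w; apply: (@generated_ind _ _
  (fun w => exists g : weyl_group F R, restricts_to w (gen_val g)) _ _ _ (gen_valP w)).
  split=> [|f f' [g fg] [g' fg']|f [g fg]].
  - by exists 1%g; exact: restricts_to1.
  - by exists (g * g')%g; exact: restricts_toM.
  - by exists g^-1%g; exact: restricts_toV.
move=> {}w [a Ra wE]; have [g gE] := weyl_reflection_exists ars Ra.
have gW : g \in generated (weyl_reflections F R) by apply: mem_generated; exists a.
by exists (GenGroup gW); apply: reflection_restricts_to wE gE.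
Qed.

(** This provides the surjectivity of phi. *)
Lemma weyl_lifts (g : weyl_group F R) :
  exists w : hyperbolic_weyl_group R B, restricts_to (gen_val w) (gen_val g).
Proof.
have [[Bl Bs _] _] := formB.
apply: (@generated_ind _ _ (fun g => exists w : hyperbolic_weyl_group R B,
  restricts_to (gen_val w) g) _ _ _ (gen_valP g)).
  split=> [|f f' [w wf] [w' wf']|f [w wf]].
  - by exists 1%g; exact: restricts_to1.
  - by exists (w * w')%g; exact: restricts_toM.
  - by exists w^-1%g; exact: restricts_toV.
move=> {}g [a Ra gE].
have [w wE] := linear_reflection_exists (Qinj a, 0 : V0_dagger lambda) Bl Bs.
have wW : w \in generated (hyperbolic_reflections R B).
  by apply: mem_generated; exists a.
by exists (GenGroup wW); apply: reflection_restricts_to wE gE.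
Qed.

Lemma fix_V_central (z : hyperbolic_weyl_group R B) :
  restricts_to (gen_val z) 1%g -> forall w, commute z w.
Proof.
move=> z1 w; apply: val_inj.
apply: (@generated_ind _ _ (fun w => commute (gen_val z) w) _ _ _ (gen_valP w)).
  split=> [|f g zf zg|f zf]; [exact: commute1|exact: commuteM|exact: commuteV].
move=> {}w [a Ra wE]; apply: (isometry_commute _ (hyperbolic_isometry z) wE).
by rewrite z1 Qmap1.
Qed.

Lemma central_fix_V (z : hyperbolic_weyl_group R B) (S : set A) :
  torsion_free A -> A1_datum F R eps S ->
  (exists2 a : A, a \in radical F & a != 0) ->
  (forall w, commute z w) -> restricts_to (gen_val z) 1%g.
Proof.
move=> tA [[RE SR S0 _ Sgen] [dec F2]] [a0 a0rad a0N0] zC.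
have [[Bl Bs _] [BE _ _ _]] := formB.
have Srad s : S s -> s \in radical F by move=> /SR[].
have zD u v : gen_val z (u + v, 0) = gen_val z (u, 0) + gen_val z (v, 0).
  have /asboolP/(_ 1 (u, 0) (v, 0)) := GL_valP (gen_val z).
  rewrite !scale1r => <-; congr (gen_val z _).
  by congr (_, _); rewrite /= addr0.
have zZ k u : gen_val z (k *: u, 0) = k *: gen_val z (u, 0).
  have /asboolP zl := GL_valP (gen_val z).
  have z0 : gen_val z 0 = 0 by have := zl (-1) 0 0; rewrite scaler0 addr0 scaleN1r addNr.
  have := zl k (u, 0) 0; rewrite z0 !addr0 => <-; congr (gen_val z _).
  by congr (_, _); rewrite /= scaler0.
(* Each [eps + s] is a root of square length 2, and [z] commutes with its reflection. *)
have zR s : S s -> gen_val z (Qinj (eps + s), 0) = (Qinj (eps + s), 0)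
    \/ gen_val z (Qinj (eps + s), 0) = (- Qinj (eps + s), 0).
  move=> Ss; have [w wE] :=
    linear_reflection_exists (Qinj (eps + s), 0 : V0_dagger lambda) Bl Bs.
  have wW : w \in generated (hyperbolic_reflections R B).
    apply: mem_generated; exists (eps + s) => //.
    by rewrite RE; right; exists eps; [left; right|exists s].
  have zw : commute (gen_val z) w by have /(congr1 (@gen_val _ _)) := zC (GenGroup wW).
  have [] := commute_reflection _ Bl Bs (hyperbolic_isometry z) wE _ zw.
  - have /asboolP s0 := Srad _ Ss.
    rewrite BE -{1}[Qinj _]scale1r Qform_Qinj mul1r form_additive !form_additivel.
    by rewrite (form_sym F eps s) !s0 F2 !addr0.
  - by move=> zE; left.
  - by move=> zN; right; rewrite zN; congr (_, _); rewrite /= oppr0.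
(* Otherwise the radical, being generated by [S], would vanish, against [a0]. *)
have [s Ss sN0] : exists2 s, S s & s != 0.
  apply: contrapT => nS; have : [set a | a \in radical F] a0 by [].
  rewrite -Sgen => /(_ [set 0]) /=.
  move=> a0E; move/eqP: a0N0; apply; apply: a0E.
  split=> [|s Ss]; first by split=> // [x y -> ->|x ->]; rewrite ?addr0 ?oppr0.
  by apply: contrapT => /eqP sN0; apply: nS; exists s.
have Qinj_eq0 (a : A) : Qinj a = 0 -> a = 0.
  by move=> e; apply: (Qinj_inj tA); rewrite e Qinj0.
have double (a : A) : a + a = 0 -> a = 0 by rewrite -mulr2n; exact: tA.
have zeps : gen_val z (Qinj eps, 0) = (Qinj eps, 0).
  have [] := zR 0 S0; rewrite addr0 // => zN; exfalso.
  (* Now z (eps + s) = - eps + s. If this is eps + s, then 2 eps = 0, against [F2]; if it is - eps -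
     s, then 2 s = 0. *)
  have := zR s Ss; rewrite Qinj_is_additive zD zN hyperbolic_fix_radical ?Srad //.
  case=> -[]; rewrite ?opprD.
    move=> /addIr /eqP; rewrite eq_sym -addr_eq0 -Qinj_is_additive.
    move=> /eqP/Qinj_eq0/double.
    move=> eps0; have /asboolP/(_ 0) := rpred0 (radical F).
    by move: F2; rewrite eps0 => ->.
  move=> /addrI /eqP; rewrite -addr_eq0 -Qinj_is_additive.
  move=> /eqP/Qinj_eq0/double sE.
  by rewrite sE eqxx in sN0.
move=> v; rewrite Qmap1; have [q [a ->]] := Qtensor_gen v.
have [[n r] [[/= rr ->] _]] := dec a.
rewrite zZ Qinj_is_additive zD QinjMz zZ zeps hyperbolic_fix_radical //.
by congr (_, _); rewrite /= !(scaler0, addr0).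
Qed.

End Restriction.

(** A nonzero radical is assumed because otherwise the hyperbolic Weyl group has order 2, generated
    by the reflection in [eps]: it is its own center, yet this reflection acts on V as -1. *)
Theorem corollary3p10
  (A : zmodType) (F : psd_form A) (R : set A)
  (J : eqType) (eps : A) (S : set A)
  (sigma : J -> radical_group F) (lambda : J -> {scalar V0 F})
  (B : Vtilde lambda -> Vtilde lambda -> rat) :
  torsion_free A ->
  affine_reflection_system F R -> irreducible F R -> tame F R -> type_A1 F R ->
  A1_datum F R eps S ->
  (forall j, S (sigma j)) ->
  is_basis (fun j => Qinj (sigma j) : V0 F) ->
  dual_family sigma lambda ->
  hyperbolic_form eps B ->
  (exists2 a : A, a \in radical F & a != 0) ->
  exists phi : {multiplicative hyperbolic_weyl_group R B -> weyl_group F R},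
    (forall (w : hyperbolic_weyl_group R B) (v : Qtensor A),
        gen_val w (v, 0) = (Qmap (gen_val (phi w)) v, 0)) /\
    central_extension (@center_val (hyperbolic_weyl_group R B)) phi.
Proof.
move=> tA ars _ _ _ datum _ _ _ formB radN0.
have /choice[f fP] := hyperbolic_restricts R eps B formB ars.
(* The chosen restriction is unique, and [f x * f y] is also a restriction of [x * y]. *)
have fM : {morph f : x y / (x * y)%g}.
  move=> x y; apply/val_inj/(restricts_to_uniq _ _ _ tA (fP _)).
  exact: restricts_toM (fP x) (fP y).
pose mult := isMultiplicative.Build _ _ f fM.
pose phi : {multiplicative hyperbolic_weyl_group R B -> weyl_group F R} :=
  HB.pack f mult.
exists phi; split; first exact: fP.
split; last by move=> z; apply/asboolP; exact: center_valP.
split; first exact: val_inj.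
(* First the center lies in the kernel, then the kernel in the center. *)
- apply/seteqP; split=> z.
    move=> [[y yC] _ <-] /=; apply/val_inj/(restricts_to_uniq _ _ _ tA (fP _)).
    by apply: central_fix_V datum radN0 _ => //; apply/asboolP.
  move=> /= fz; have zC : z \in @center_pred (hyperbolic_weyl_group R B).
    by apply/asboolP/(fix_V_central _ _ _ formB); have := fP z; rewrite fz.
  by exists (CenterGroup zC).
- apply/seteqP; split=> // g _.
  have [w wg] := weyl_lifts R eps B formB g; exists w => //.
  exact/val_inj/(restricts_to_uniq _ _ _ tA (fP _)).
Qed.
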